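(* Let $(W,C,\le)$ be a compatibility frame. The consequent $\alpha\wedge\sim\alpha\vdash\beta\vee\sim\beta$ is valid in $(W,C,\le)$ (for all formulae $\alpha,\beta\in\mathcal{F}$) if and only if the compatibility relation $C$ satisfies $$( * )\qquad \forall x\,\bigl(xCx\ \vee\ \forall y\,(xCy\rightarrow y\le x)\bigr).$$ Moreover, the canonical frame for the logic $\mathcal{L}_K$ satisfies $( * )$.
   Context: $\mathcal{F}$ is the set of formulae built from propositional variables and constants $\top,\bot$ using $\vee,\wedge,\sim$. A compatibility frame is a triple $(W,C,\le)$ where $(W,\le)$ is a partially ordered set and $C$ is a binary relation on $W$ such that $x'\le x$, $y'\le y$ and $xCy$ imply $x'Cy'$. An evaluation is a relation $\vDash$ between points of $W$ and propositional variables such that $x\vDash p$ and $x\le y$ imply $y\vDash p$; it is extended to $\mathcal{F}$ by: $x\vDash\alpha\wedge\beta$ iff $x\vDash\alpha$ and $x\vDash\beta$; $x\vDash\alpha\vee\beta$ iff $x\vDash\alpha$ or $x\vDash\beta$; $x\vDash\top$; $x\nvDash\bot$; $x\vDash\sim\alpha$ iff for all $y$, $xCy$ implies $y\nvDash\alpha$. A consequent $\alpha\vdash\beta$ is valid in the frame if for every evaluation and every $x\in W$, $x\vDash\alpha$ implies $x\vDash\beta$. Logic $\mathcal{L}_K$: derivability of consequents is given by the following postulates and rules (premises before ''/'', conclusion after), for all $\alpha,\beta,\gamma\in\mathcal{F}$: 1. $\alpha\vdash\alpha$. 2. $\alpha\vdash\beta,\ \beta\vdash\gamma\ /\ \alpha\vdash\gamma$.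 3. $\alpha\wedge\beta\vdash\alpha$, $\alpha\wedge\beta\vdash\beta$. 4. $\alpha\vdash\beta,\ \alpha\vdash\gamma\ /\ \alpha\vdash\beta\wedge\gamma$. 5. $\alpha\vdash\gamma,\ \beta\vdash\gamma\ /\ \alpha\vee\beta\vdash\gamma$. 6. $\alpha\vdash\alpha\vee\beta$, $\beta\vdash\alpha\vee\beta$. 7. $\alpha\wedge(\beta\vee\gamma)\vdash(\alpha\wedge\beta)\vee(\alpha\wedge\gamma)$. 8. $\alpha\vdash\beta\ /\ \sim\beta\vdash\sim\alpha$. 9. $\sim\alpha\wedge\sim\beta\vdash\sim(\alpha\vee\beta)$. 10. $\alpha\vdash\top$. 11. $\bot\vdash\alpha$. 12. $\top\vdash\sim\bot$. 13. $\alpha\vdash\sim\sim\alpha$. 14. $\sim\sim\alpha\vdash\alpha$. 15. $\alpha\wedge\sim\alpha\vdash\beta\vee\sim\beta$. A prime theory of $\mathcal{L}_K$ is a set $P\subseteq\mathcal{F}$ such that: if $\alpha\vdash\beta$ is derivable and $\alpha\in P$ then $\beta\in P$; if $\alpha,\beta\in P$ then $\alpha\wedge\beta\in P$; $\top\in P$ and $\bot\notin P$; if $\alpha\vee\beta\in P$ then $\alpha\in P$ or $\beta\in P$. The canonical frame for $\mathcal{L}_K$ is $(W_c,C_c,\subseteq)$, where $W_c$ is the set of all (non-trivial) prime theories and $P_1C_cP_2$ iff for all $\alpha\in\mathcal{F}$, $\sim\alpha\in P_1$ implies $\alpha\notin P_2$. *)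

(* Defs.v *)
From Stdlib Require Import Relations Ensembles.
From Stdlib Require Import FunctionalExtensionality PropExtensionality.
From Stdlib Require Import ProofIrrelevance.

Inductive formula : Type :=
| Var (p : nat)
| Top
| Bot
| Or (a b : formula)
| And (a b : formula)
| Neg (a : formula).

Declare Scope formula_scope.
Delimit Scope formula_scope with F.
Bind Scope formula_scope with formula.
Notation "~ a" := (Neg a) : formula_scope.
Notation "a /\ b" := (And a b) : formula_scope.
Notation "a \/ b" := (Or a b) : formula_scope.

(* The carrier may be empty. *)
Record compat_frame : Type := CompatFrame {
  point :> Type;
  compat : relation point;
  le : relation point;
  le_order : order point le;
  compat_down : forall x x' y y' : point,
    le x' x -> le y' y -> compat x y -> compat x' y'
}.

Arguments compat {_} _ _.
Arguments le {_} _ _.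

Record evaluation (W : compat_frame) : Type := Evaluation {
  holds :> W -> nat -> Prop;
  holds_up : forall (x y : W) (p : nat), holds x p -> le x y -> holds y p
}.

Fixpoint sat {W : compat_frame} (v : evaluation W) (x : W) (a : formula)
    : Prop :=
  match a with
  | Var p => v x p
  | Top => True
  | Bot => False
  | Or b c => sat v x b \/ sat v x c
  | And b c => sat v x b /\ sat v x c
  | Neg b => forall y : W, compat x y -> ~ sat v y b
  end.

Definition valid (W : compat_frame) (a b : formula) : Prop :=
  forall (v : evaluation W) (x : W), sat v x a -> sat v x b.

Reserved Notation "a |-K b" (at level 90, no associativity).

Inductive derivable_K : formula -> formula -> Prop :=
| K_refl a : a |-K a
| K_trans a b c : a |-K b -> b |-K c -> a |-K c
| K_and_l a b : (a /\ b)%F |-K a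
| K_and_r a b : (a /\ b)%F |-K b
| K_and_intro a b c : a |-K b -> a |-K c -> a |-K (b /\ c)%F
| K_or_elim a b c : a |-K c -> b |-K c -> (a \/ b)%F |-K c
| K_or_l a b : a |-K (a \/ b)%F
| K_or_r a b : b |-K (a \/ b)%F
| K_distr a b c : (a /\ (b \/ c))%F |-K ((a /\ b) \/ (a /\ c))%F
| K_contra a b : a |-K b -> (~ b)%F |-K (~ a)%F
| K_neg_or a b : (~ a /\ ~ b)%F |-K (~ (a \/ b))%F
| K_top a : a |-K Top
| K_bot a : Bot |-K a
| K_neg_bot : Top |-K (~ Bot)%F
| K_dn_intro a : a |-K (~ ~ a)%F
| K_dn_elim a : (~ ~ a)%F |-K a
| K_kleene a b : (a /\ ~ a)%F |-K (b \/ ~ b)%F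
where "a |-K b" := (derivable_K a b).

Record prime_theory (P : Ensemble formula) : Prop := PrimeTheory {
  prime_closed : forall a b : formula, a |-K b -> In _ P a -> In _ P b;
  prime_and : forall a b : formula, In _ P a -> In _ P b -> In _ P (a /\ b)%F;
  prime_top : In _ P Top;
  prime_bot : ~ In _ P Bot;
  prime_or : forall a b : formula, In _ P (a \/ b)%F -> In _ P a \/ In _ P b
}.

Definition canonical_point : Type := {P : Ensemble formula | prime_theory P}.

Definition canonical_compat (P Q : canonical_point) : Prop :=
  forall a : formula, In _ (proj1_sig P) (~ a)%F -> ~ In _ (proj1_sig Q) a.

Definition canonical_le (P Q : canonical_point) : Prop :=
  Included _ (proj1_sig P) (proj1_sig Q).

Lemma canonical_le_order : order canonical_point canonical_le.
Proof.
split.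
- intros P a Ha; exact Ha.
- intros P Q S HPQ HQS a Ha; exact (HQS a (HPQ a Ha)).
- intros [P HP] [Q HQ] HPQ HQP; apply subset_eq_compat.
  apply functional_extensionality; intro a.
  apply propositional_extensionality; split; [exact (HPQ a) | exact (HQP a)].
Qed.

Lemma canonical_compat_down (P P' Q Q' : canonical_point) :
  canonical_le P' P -> canonical_le Q' Q ->
  canonical_compat P Q -> canonical_compat P' Q'.
Proof.
intros HP HQ H a Ha Hb; exact (H a (HP _ Ha) (HQ _ Hb)).
Qed.

Definition canonical_frame_K : compat_frame :=
  CompatFrame canonical_point canonical_compat canonical_le
    canonical_le_order canonical_compat_down.

Definition kleene_condition (W : compat_frame) : Prop :=
  forall x : W, compat x x \/ (forall y : W, compat x y -> le y x).

(* Main.v *)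
(** In one direction, if [x] is not compatible with itself but [x C y] and not
    [y <= x], then the evaluation sending [p] to [{z | not x C z}] and [q] to
    [{z | y <= z}] makes [p] and [~ p] true at [x], and [q] and [~ q] false at
    [x].  Conversely, a point satisfying [a] and [~ a] is not self-compatible,
    so all points compatible with it lie below it, and by persistence they
    refute every [b] that it refutes.  In the canonical frame, a prime theory
    that is not self-compatible contains some [a] and [~ a], hence [b] or [~ b]
    for every [b]. *)
From Stdlib Require Import Relations Ensembles Classical.
Require Import Defs.

(** Negation persists because every point compatible with [y] is already compatible with the lower
    [x]. *)
Lemma sat_up {W : compat_frame} (v : evaluation W) (a : formula) (x y : W) :
  le x y -> sat v x a -> sat v y a.
Proof.
revert x y; induction a as [p | | | b IHb c IHc | b IHb c IHc | b _];
  intros x y Hxy; simpl.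
- intro Hx; exact (holds_up W v x y p Hx Hxy).
- trivial.
- trivial.
- intros [Hb | Hc]; [left; exact (IHb x y Hxy Hb) | right; exact (IHc x y Hxy Hc)].
- intros [Hb Hc]; split; [exact (IHb x y Hxy Hb) | exact (IHc x y Hxy Hc)].
- intros Hx z Hyz; apply Hx.
  exact (compat_down W y x z z Hxy (ord_refl _ _ (le_order W) z) Hyz).
Qed.

Lemma kleene_condition_valid (W : compat_frame) (a b : formula) :
  kleene_condition W -> valid W (a /\ ~ a)%F (b \/ ~ b)%F.
Proof.
intros HW v x [Ha Hna].
destruct (HW x) as [Hxx | Hbelow]; [destruct (Hna x Hxx Ha) |].
destruct (classic (sat v x b)) as [Hb | Hb]; [left; exact Hb | right].
intros y Hxy Hy; exact (Hb (sat_up v b y x (Hbelow y Hxy) Hy)).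
Qed.

(** The set for [0] is up-closed since compatibility is inherited downwards in its second argument,
    the other by transitivity. Transparent, so that [sat] computes on it. *)
Definition separating_evaluation {W : compat_frame} (x y : W) : evaluation W.
Proof.
refine (Evaluation W
  (fun z p => match p with 0 => ~ compat x z | _ => le y z end) _).
intros z w [|p] Hz Hzw.
- intro Hxw; apply Hz.
  exact (compat_down W x x w z (ord_refl _ _ (le_order W) x) Hzw Hxw).
- exact (ord_trans _ _ (le_order W) y z w Hz Hzw).
Defined.

Lemma valid_kleene_condition (W : compat_frame) :
  valid W (Var 0 /\ ~ Var 0)%F (Var 1 \/ ~ Var 1)%F -> kleene_condition W.
Proof.
intros HW x.
destruct (classic (compat x x)) as [Hxx | Hxx]; [left; exact Hxx | right].
intros y Hxy.
destruct (HW (separating_evaluation x y) x) as [Hyx | Hn].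
- split; [exact Hxx | intros z Hxz Hz; exact (Hz Hxz)].
- exact Hyx.
- destruct (Hn y Hxy (ord_refl _ _ (le_order W) y)).
Qed.

Lemma canonical_kleene_condition : kleene_condition canonical_frame_K.
Proof.
intro P; destruct (classic (compat P P)) as [HPP | HPP]; [left; exact HPP | right].
intros Q HPQ b HbQ.
destruct (not_all_ex_not _ _ HPP) as [a Ha].
apply imply_to_and in Ha as [Hna Ha]; apply NNPP in Ha.
pose proof (proj2_sig P) as HP.
destruct (prime_or _ HP b (~ b)%F) as [Hb | Hnb].
- exact (prime_closed _ HP _ _ (K_kleene a b) (prime_and _ HP _ _ Ha Hna)).
- exact Hb.
(* [~ b] in [P] would exclude [b] from the compatible [Q]. *)
- destruct (HPQ b Hnb HbQ).
Qed.

Theorem theorem19 :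
  (forall W : compat_frame,
     (forall a b : formula, valid W (a /\ ~ a)%F (b \/ ~ b)%F) <->
     kleene_condition W) /\
  kleene_condition canonical_frame_K.
Proof.
split; [intro W; split | exact canonical_kleene_condition].
- intro HW; exact (valid_kleene_condition W (HW (Var 0) (Var 1))).
- intros HW a b; exact (kleene_condition_valid W a b HW).
Qed.
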